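(* Let $g^{kij}$ ($k,i,j\in\{0,1,2\}$) be real constants with $g^{kij}=g^{kji}$. (i) If $g^{kij}$ satisfies the standard null condition $g^{kij}\omega_k\omega_i\omega_j=0$ for every null vector $\omega$, then there are constants $C_{m,l}$ such that $$g^{kij}\partial_k u\,\partial_{ij}u=\sum_{l=0}^2 C_{1,l}F^A_l+\sum_{l=0}^2 C_{2,l}F^B_l+\sum_{l=1}^2 C_{3,l}F^C_l+\sum_{l=1}^3 C_{4,l}F^D_l .$$ (ii) If $g^{kij}$ satisfies the strong null condition, i.e. both $g^{kij}\omega_k\omega_i\omega_j=0$ and $(g^{1ij}\omega_2-g^{2ij}\omega_1)\omega_i\omega_j=0$ for every null vector $\omega$, then there are constants $C_{m,l}$ such that $$g^{kij}\partial_k u\,\partial_{ij}u=\sum_{l=0}^2 C_{1,l}F^A_l+\sum_{l=0}^2 C_{2,l}F^B_l .$$ (iii) If $A_l$, $N_{ij}$ ($l,i,j\in\{0,1,2\}$) are real constants and $N_{ij}\omega_i\omega_j=0$ for every null vector $\omega$, then there are constants $C_{1,l}$ such that $$A_l\,\partial_l\big(N_{ij}\,\partial_i u\,\partial_j u\big)=\sum_{l=0}^2 C_{1,l}F^A_l .$$ Here the constants depend only on the coefficients, and the identities hold for all (sufficiently smooth) functions $u=u(t,x)$.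
   Context: Coordinates $(t,x)$, $x=(x_1,x_2)\in\mathbb R^2$; $\partial_0=\partial_t$, $\partial_l=\partial_{x_l}$ ($l=1,2$), $\partial_{ij}=\partial_i\partial_j$, $\nabla=(\partial_1,\partial_2)$, $\square=\partial_{tt}-\Delta$. Repeated indices are summed over $\{0,1,2\}$. A null vector is $\omega=(\omega_0,\omega_1,\omega_2)=(-1,\cos\theta,\sin\theta)$ with $\theta\in[0,2\pi]$. The null forms are: $$F^A_i=\partial_i\big(|\partial_t u|^2-|\nabla u|^2\big),\quad i=0,1,2;\qquad F^B_i=\partial_i u\,\square u,\quad i=0,1,2;$$ $$F^C_1=\partial_0u\,\partial_{12}u-\partial_1u\,\partial_{02}u,\qquad F^C_2=\partial_1u\,\partial_{02}u-\partial_2u\,\partial_{01}u;$$ $$F^D_1=\partial_0u\,\partial_{11}u-\partial_1u\,\partial_{01}u,\qquad F^D_2=\partial_1u\,\partial_{22}u-\partial_2u\,\partial_{12}u,\qquad F^D_3=\partial_2u\,\partial_{11}u-\partial_1u\,\partial_{12}u.$$ *)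

(* Defs.v *)
From mathcomp Require Import all_boot all_order all_algebra.
From mathcomp Require Import all_classical all_reals all_analysis.
Import Order.TTheory GRing.Theory Num.Theory.
Import numFieldNormedType.Exports.

Set Implicit Arguments.
Unset Strict Implicit.
Unset Printing Implicit Defensive.

Local Open Scope classical_set_scope.
Local Open Scope ring_scope.

(* A point (t, x_1, x_2) is a row vector of 'rV[R]_3; its coordinate 0 is the
   time.  The indices 0, 1, 2 : 'I_3 are the ring numerals of 'I_3 = Z/3. *)

Section Calculus.
Variable R : realType.
Implicit Types (u : 'rV[R]_3 -> R) (p : 'rV[R]_3).

Definition partial (i : 'I_3) u : 'rV[R]_3 -> R :=
  fun p => 'D_(delta_mx 0 i : 'rV[R]_3) u p.

Fixpoint Ck (k : nat) u : Prop :=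
  continuous u /\
  (if k is k'.+1 then
     forall i : 'I_3,
       (forall p, derivable u p (delta_mx 0 i : 'rV[R]_3)) /\
       Ck k' (partial i u)
   else True).

Definition box u p : R :=
  partial 0 (partial 0 u) p
  - (partial 1 (partial 1 u) p + partial 2 (partial 2 u) p).

Definition FA u (i : 'I_3) p : R :=
  partial i (fun q => (partial 0 u q) ^+ 2
                      - ((partial 1 u q) ^+ 2 + (partial 2 u q) ^+ 2)) p.

Definition FB u (i : 'I_3) p : R := partial i u p * box u p.

(* FC and FD are indexed from 1; their values at indices outside {1, 2},
   respectively {1, 2, 3}, are irrelevant. *)
Definition FC u (l : nat) p : R :=
  match l with
  | 1 => partial 0 u p * partial 1 (partial 2 u) p
         - partial 1 u p * partial 0 (partial 2 u) p
  | 2 => partial 1 u p * partial 0 (partial 2 u) p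
         - partial 2 u p * partial 0 (partial 1 u) p
  | _ => 0
  end.

Definition FD u (l : nat) p : R :=
  match l with
  | 1 => partial 0 u p * partial 1 (partial 1 u) p
         - partial 1 u p * partial 0 (partial 1 u) p
  | 2 => partial 1 u p * partial 2 (partial 2 u) p
         - partial 2 u p * partial 1 (partial 2 u) p
  | 3 => partial 2 u p * partial 1 (partial 1 u) p
         - partial 1 u p * partial 1 (partial 2 u) p
  | _ => 0
  end.

End Calculus.

Section NullConditions.
Variable R : realType.

Definition null_vector (w : 'I_3 -> R) : Prop :=
  exists2 theta : R, 0 <= theta <= 2 * pi &
    [/\ w 0 = -1, w 1 = cos theta & w 2 = sin theta].

(* g k i j stands for g^{kij} *)
Implicit Types g : 'I_3 -> 'I_3 -> 'I_3 -> R.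

Definition null_condition g : Prop :=
  forall w, null_vector w ->
    \sum_(k < 3) \sum_(i < 3) \sum_(j < 3) g k i j * w k * w i * w j = 0.

Definition strong_null_condition g : Prop :=
  null_condition g /\
  (forall w, null_vector w ->
    \sum_(i < 3) \sum_(j < 3) (g 1 i j * w 2 - g 2 i j * w 1) * w i * w j = 0).

Definition quadratic_term g (u : 'rV[R]_3 -> R) (p : 'rV[R]_3) : R :=
  \sum_(k < 3) \sum_(i < 3) \sum_(j < 3)
    g k i j * partial k u p * partial i (partial j u) p.

Definition quadratic_null_condition (N : 'I_3 -> 'I_3 -> R) : Prop :=
  forall w, null_vector w -> \sum_(i < 3) \sum_(j < 3) N i j * w i * w j = 0.

End NullConditions.

(* Main.v *)
Require Import Defs.
From mathcomp Require Import all_boot all_order all_algebra.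
From mathcomp Require Import all_classical all_reals all_analysis.
From mathcomp Require Import ring lra.
Import Order.TTheory GRing.Theory Num.Theory.
Import numFieldNormedType.Exports.
Local Open Scope classical_set_scope.
Local Open Scope ring_scope.

(** On the circle x^2 + y^2 = 1 a cubic in (-1, x, y) reduces to
    a + b x + c y + d x y + e y^2 + f x y^2 + k y^3, and these seven monomials
    are linearly independent there. Each null condition is thus equivalent to
    explicit linear relations between the coefficients; once they are solved,
    the decompositions are polynomial identities in the first and second
    derivatives of u, using the symmetry of mixed second derivatives. *)

(** * Short sums and an epsilon estimate *)

Lemma sum3E (V : nmodType) (F : 'I_3 -> V) : \sum_(i < 3) F i = F 0 + F 1 + F 2.
Proof.
rewrite !big_ord_recl big_ord0 addr0 addrA.
by congr (F _ + F _ + F _); apply/val_inj.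
Qed.

Lemma sum_nat13 (V : nmodType) (F : nat -> V) :
  \sum_(1 <= l < 3) F l = F 1%N + F 2%N.
Proof. by rewrite unlock /= addr0. Qed.

Lemma sum_nat14 (V : nmodType) (F : nat -> V) :
  \sum_(1 <= l < 4) F l = F 1%N + F 2%N + F 3%N.
Proof. by rewrite unlock /= addr0 addrA. Qed.

(** Closing estimate of [schwarz]: [x] and [y] are the two mixed derivatives at the base point, [z]
    and [w] their values at nearby points where they agree. *)
Lemma dist_le_near_eq (R : realFieldType) (e x y z w : R) :
  z = w -> `|x - z| < e / 2 -> `|y - w| < e / 2 -> `|x - y| <= e.
Proof.
move=> <- xz yz; rewrite (le_trans (ler_distD z _ _))// [e]splitr (distrC z).
by rewrite ltW// ltrD.
Qed.

(** * Symmetry of mixed directional derivatives *)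

Section Schwarz.
Context {R : realType} {V : normedModType R}.
Implicit Types (f : V -> R) (p a b : V).

(** Both difference quotients are the same function of the increment, so derivability and value
    transfer together; one-variable calculus then applies along a line. *)
Lemma is_derive_line f p a (s : R) : derivable f (p + s *: a) a ->
  is_derive s 1 (fun r => f (p + r *: a)) ('D_a f (p + s *: a)).
Proof.
have lineE : (fun h : R => h^-1 *: (((fun r => f (p + r *: a)) \o shift s) (h *: 1)
      - f (p + s *: a)))
    = (fun h => h^-1 *: ((f \o shift (p + s *: a)) (h *: a) - f (p + s *: a))).
  apply/funext => h /=; congr (_ *: (f _ - _)).
  by rewrite [h *: 1]mulr1 scalerDl addrCA.
by move=> df; split; rewrite /derivable /derive lineE.
Qed.

Lemma MVT_line f p a (h : R) : (forall q, derivable f q a) -> 0 < h ->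
  exists2 c, 0 < c < h & f (p + h *: a) - f p = 'D_a f (p + c *: a) * h.
Proof.
move=> df h0.
have dl s := is_derive_line f p a s (df _).
have [|c] := @MVT R (fun r => f (p + r *: a)) (fun s => 'D_a f (p + s *: a)) 0 h h0
  (fun s _ => dl s).
  apply: continuous_subspaceT => s; apply: differentiable_continuous.
  by apply/derivable1_diffP; case: (dl s).
by rewrite in_itv /= scale0r addr0 subr0 => ch E; exists c.
Qed.

(* Mean value theorem along [a] for [q |-> f (q + h b) - f q], then along [b]
   for ['D_a f]. *)
Lemma second_difference f p a b (h : R) :
    (forall q, derivable f q a) -> (forall q, derivable ('D_a f) q b) -> 0 < h ->
  exists c d, [/\ 0 < c < h, 0 < d < h &
    f (p + h *: a + h *: b) - f (p + h *: a) - (f (p + h *: b) - f p)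
    = 'D_b ('D_a f) (p + c *: a + d *: b) * h ^+ 2].
Proof.
move=> df ddf h0.
pose g q := f (q + h *: b) - f q.
(* Difference quotients commute with translation by [h *: b]. This serves twice: for derivability of
   the translate and for the value of its derivative. *)
have shE (q : V) : (fun k : R => k^-1 *: (((fun q => f (q + h *: b)) \o shift q) (k *: a)
      - f (q + h *: b)))
    = (fun k => k^-1 *: ((f \o shift (q + h *: b)) (k *: a) - f (q + h *: b))).
  by apply/funext => k /=; rewrite addrA.
have dsh q : derivable (fun q => f (q + h *: b)) q a.
  by rewrite /derivable shE; exact: df.
have dg q : derivable g q a by apply: derivableB.
have [c ch] := MVT_line g p a h dg h0.
have -> : 'D_a g (p + c *: a)
    = 'D_a f (p + c *: a + h *: b) - 'D_a f (p + c *: a).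
  by rewrite [LHS](deriveB (dsh _) (df _)) {1}/derive shE.
have [d dh ->] := MVT_line ('D_a f) (p + c *: a) b h ddf h0.
by move=> E; exists c, d; split=> //; rewrite expr2 mulrA -E.
Qed.

Lemma near_parallelogram (P : V -> Prop) p a b : (\forall q \near p, P q) ->
  exists2 h : R, 0 < h &
    forall c d, 0 < c < h -> 0 < d < h -> P (p + c *: a + d *: b).
Proof.
move=> /nbhs_ballP[e /= e0 Pe].
have m0 : 0 < `|a| + `|b| + 1 by rewrite ltr_wpDl ?addr_ge0.
(* The summand 1 keeps the denominator positive when [a] and [b] vanish. The displacement has norm
   at most max(c, d) (|a| + |b|), which is below [e]. *)
exists (e / (`|a| + `|b| + 1)); first by rewrite divr_gt0.
move=> c d /andP[c0]; rewrite ltr_pdivlMr// => ce /andP[d0].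
rewrite ltr_pdivlMr// => de.
apply: Pe; rewrite -ball_normE /ball_ /= -addrA opprD addNKr normrN.
apply: le_lt_trans (ler_normD _ _) _.
rewrite !normrZ !gtr0_norm//.
have := normr_ge0 a; have := normr_ge0 b; nra.
Qed.

(** The second difference over the parallelogram spanned by [h *: a] and [h *: b] is symmetric in
    [a] and [b]. By [second_difference] it is [h ^+ 2] times either mixed derivative at some
    interior point; continuity at [p] brings both values within e/2 of those at [p]. *)
Lemma schwarz f p a b :
    (forall q, derivable f q a) -> (forall q, derivable f q b) ->
    (forall q, derivable ('D_a f) q b) -> (forall q, derivable ('D_b f) q a) ->
    {for p, continuous ('D_b ('D_a f))} -> {for p, continuous ('D_a ('D_b f))} ->
  'D_b ('D_a f) p = 'D_a ('D_b f) p.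
Proof.
move=> da db dab dba cab cba; apply/eqP; rewrite -subr_eq0 -normr_le0.
apply/ler_addgt0Pl => e e0; rewrite addr0.
have e2 : 0 < e / 2 by rewrite divr_gt0.
have [h1 h10 near1] := near_parallelogram _ p a b
  (cvgr_dist_lt (FF := nbhs_filter p) _ _ cab _ e2).
have [h2 h20 near2] := near_parallelogram _ p b a
  (cvgr_dist_lt (FF := nbhs_filter p) _ _ cba _ e2).
pose h := Num.min h1 h2.
have h0 : 0 < h by rewrite lt_min h10.
have lth1 c : 0 < c < h -> 0 < c < h1.
  by rewrite lt_min => /and3P[-> ->].
have lth2 c : 0 < c < h -> 0 < c < h2.
  by rewrite lt_min => /and3P[-> _ ->].
have [c [d [ch dh E]]] := second_difference f p a b h da dab h0.
have [c' [d' [ch' dh' E']]] := second_difference f p b a h db dba h0.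
have EE' : 'D_b ('D_a f) (p + c *: a + d *: b)
     = 'D_a ('D_b f) (p + c' *: b + d' *: a).
  apply: (@mulIf _ (h ^+ 2)); first by rewrite expf_neq0 ?gt_eqF.
  apply: etrans (esym E) (etrans _ E').
  by rewrite (addrAC p (h *: b)) opprD addrACA -opprD.
exact: dist_le_near_eq EE' (near1 _ _ (lth1 _ ch) (lth1 _ dh))
  (near2 _ _ (lth2 _ ch') (lth2 _ dh')).
Qed.

End Schwarz.

(** * Null vectors as points of the unit circle *)

Section NullVectors.
Context {R : realType}.
Implicit Types (x y : R).

(** [acos x] covers the upper half circle; for negative [y] the angle 2 pi - [acos x] has the same
    cosine and the opposite sine. *)
Lemma circle_angle x y : x ^+ 2 + y ^+ 2 = 1 ->
  exists2 t : R, 0 <= t <= 2 * pi & cos t = x /\ sin t = y.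
Proof.
move=> xy.
have x1 : -1 <= x <= 1 by apply/andP; split; nra.
have /andP[a0 api] : 0 <= acos x <= pi by rewrite acos_ge0 ?acos_lepi.
have pi0 := pi_ge0 R.
have ca : cos (acos x) = x by rewrite acosK // in_itv.
have sa : sin (acos x) = `|y|.
  by rewrite sin_acos// -xy addrC addKr sqrtr_sqr.
case: (lerP 0 y) => y0.
  by exists (acos x); [apply/andP; split; lra|rewrite ca sa ger0_norm].
exists (pi *+ 2 - acos x); first by rewrite -mulr_natl; apply/andP; split; lra.
rewrite addrC cosD2pi sinD2pi cosN sinN ca sa ltr0_norm ?opprK//.
Qed.

(** Using a point of the circle instead of an angle makes the null conditions polynomial and allows
    evaluation at rational points. *)
Definition circle_point x y (i : 'I_3) : R :=
  if i == 0 then -1 else if i == 1 then x else y.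

Lemma circle_pointE x y :
  (circle_point x y 0 = -1) * (circle_point x y 1 = x) * (circle_point x y 2 = y).
Proof. by []. Qed.

Lemma null_circle_point x y : x ^+ 2 + y ^+ 2 = 1 ->
  null_vector (circle_point x y).
Proof. by move=> /circle_angle[t t2pi [<- <-]]; exists t. Qed.

End NullVectors.

(** * Partial derivatives of [u] and expansion of [FA] *)

Lemma is_derive_sub_squares (R : realType) (V : normedModType R)
    (a b c : V -> R) (p v : V) (da db dc : R) :
  is_derive p v a da -> is_derive p v b db -> is_derive p v c dc ->
  is_derive p v (fun q => a q ^+ 2 - (b q ^+ 2 + c q ^+ 2))
    (2 * (a p * da - b p * db - c p * dc)).
Proof.
move=> Da Db Dc.
apply: is_derive_eq (is_deriveB (is_deriveX 2 Da)
  (is_deriveD (is_deriveX 2 Db) (is_deriveX 2 Dc))) _.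
by rewrite /GRing.scale /=; ring.
Qed.

Section PartialDerivatives.
Context {R : realType}.
Implicit Types (u f : 'rV[R]_3 -> R) (p : 'rV[R]_3).

Lemma partialC u : Ck 2 u -> forall i j p,
  partial i (partial j u) p = partial j (partial i u) p.
Proof.
move=> [_ C2] i j p; rewrite /partial.
have [du [_ ddu]] := C2 i; have [dv [_ ddv]] := C2 j.
(* The hypothesis [Ck 2 u], unfolded in both orders of differentiation, provides derivability of the
   first partials and continuity of both mixed ones. *)
have [[dij [cij _]] [dji [cji _]]] := (ddv i, ddu j).
exact: schwarz dv du dij dji (cij p) (cji p).
Qed.

(** The function differentiated in [FA]: [FA u i] is [partial i (minkowski u)] by conversion. *)
Definition minkowski u : 'rV[R]_3 -> R :=
  fun q => (partial 0 u q) ^+ 2 - ((partial 1 u q) ^+ 2 + (partial 2 u q) ^+ 2).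

Lemma is_derive_minkowski u : Ck 2 u -> forall i p,
  is_derive p (delta_mx 0 i : 'rV[R]_3) (minkowski u)
    (2 * (partial 0 u p * partial i (partial 0 u) p
          - partial 1 u p * partial i (partial 1 u) p
          - partial 2 u p * partial i (partial 2 u) p)).
Proof.
move=> [_ C2] i p.
have D k : is_derive p (delta_mx 0 i : 'rV[R]_3) (partial k u)
    (partial i (partial k u) p).
  by have [_ [_ /(_ i)[dk _]]] := C2 k; exact: derivableP.
exact: is_derive_sub_squares (D 0) (D 1) (D 2).
Qed.

Lemma FAE u : Ck 2 u -> forall i p,
  FA u i p = 2 * (partial 0 u p * partial i (partial 0 u) p
                  - partial 1 u p * partial i (partial 1 u) p
                  - partial 2 u p * partial i (partial 2 u) p).
Proof. by move=> C2 i p; case: (is_derive_minkowski u C2 i p). Qed.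

Lemma partialZ_minkowski u (c : R) : Ck 2 u -> forall i p,
  partial i (fun q => c * minkowski u q) p = c * FA u i p.
Proof.
move=> C2 i p; have [dm _] := is_derive_minkowski u C2 i p.
exact: (@deriveZ _ _ _ (minkowski u) c).
Qed.

End PartialDerivatives.

(** * Linear algebra of the null conditions *)

Section NullForms.
Context {R : realType}.

(** The points (1, 0) and (-1, 0) give a = b = 0; then (0, 1) and (0, -1) give e = 0 and k = -c.
    What remains on the circle is x y (c x + d + f y), whose affine factor vanishes at three
    non-collinear points off the axes. *)
Lemma circle_cubic_eq0 (a b c d e f k : R) :
    (forall x y : R, x ^+ 2 + y ^+ 2 = 1 ->
      a + b * x + c * y + d * (x * y) + e * y ^+ 2 + f * (x * y ^+ 2)
        + k * y ^+ 3 = 0) ->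
  [/\ a = 0, b = 0, c = 0, d = 0 & [/\ e = 0, f = 0 & k = 0]].
Proof.
move=> H.
(* Rational points of the circle keep the conditions linear over Q. *)
have := H 1 0 ltac:(ring); have := H (-1) 0 ltac:(ring).
have := H 0 1 ltac:(ring); have := H 0 (-1) ltac:(ring).
have := H (3/5) (4/5) ltac:(field); have := H (3/5) (-4/5) ltac:(field).
have := H (-3/5) (4/5) ltac:(field).
by clear=> *; split; last split; lra.
Qed.

(** The arguments given to [circle_cubic_eq0] are the coefficients of the null cubic after replacing
    x^2 by 1 - y^2. Of the 18 independent entries of [g] seven are solved for; the 11 left free
    match the number of null forms. *)
Lemma null_conditionE (g : 'I_3 -> 'I_3 -> 'I_3 -> R) :
    (forall k i j, g k i j = g k j i) -> null_condition g ->
  [/\ g 0 0 0 = - 2 * g 2 0 2 - g 0 2 2,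
      g 1 0 1 = g 2 0 2 + (g 0 2 2 - g 0 1 1) / 2,
      g 1 0 2 = - g 0 1 2 - g 2 0 1 &
  [/\ g 1 1 1 = - 2 * g 0 0 1 - g 1 0 0,
      g 1 1 2 = - g 0 0 2 - (g 2 1 1 + g 2 0 0) / 2,
      g 2 1 2 = - g 0 0 1 - (g 1 2 2 + g 1 0 0) / 2 &
      g 2 2 2 = - 2 * g 0 0 2 - g 2 0 0]].
Proof.
move=> gC g0.
have [|] := @circle_cubic_eq0
  (- g 0 0 0 - g 0 1 1 - 2 * g 1 0 1) (2 * g 0 0 1 + g 1 0 0 + g 1 1 1)
  (2 * g 0 0 2 + g 2 0 0 + 2 * g 1 1 2 + g 2 1 1)
  (- 2 * (g 0 1 2 + g 1 0 2 + g 2 0 1))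
  (g 0 1 1 + 2 * g 1 0 1 - g 0 2 2 - 2 * g 2 0 2)
  (g 1 2 2 + 2 * g 2 1 2 - g 1 1 1) (g 2 2 2 - 2 * g 1 1 2 - g 2 1 1).
  move=> x y xy; have x2 : x ^+ 2 = 1 - y ^+ 2 by rewrite -xy addrK.
  rewrite -[RHS](g0 _ (null_circle_point x y xy)) !sum3E !circle_pointE.
  rewrite (gC 0 1 0) (gC 0 2 0) (gC 0 2 1) (gC 1 1 0) (gC 1 2 0) (gC 1 2 1).
  by rewrite (gC 2 1 0) (gC 2 2 0) (gC 2 2 1); ring: x2.
move=> a0 b0 c0 d0 [e0 f0 k0].
by split; last split; clear g0; lra.
Qed.

(** These five relations say exactly that the coefficients of the [FC] and [FD] terms in
    [null_formE] vanish. *)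
Lemma strong_null_conditionE (g : 'I_3 -> 'I_3 -> 'I_3 -> R) :
    (forall k i j, g k i j = g k j i) -> strong_null_condition g ->
  [/\ g 0 1 2 = 0, g 2 0 1 = 0, g 0 1 1 = g 0 2 2, g 1 2 2 = - g 1 0 0 &
      g 2 1 1 = - g 2 0 0].
Proof.
move=> gC [g0 sg0].
have [h1 h2 h3 [h4 h5 h6 h7]] := null_conditionE g gC g0.
have [|] := @circle_cubic_eq0
  (2 * g 2 0 1) (- g 2 0 0 - g 2 1 1) (g 1 0 0 + g 1 1 1 - 2 * g 2 1 2)
  (2 * g 2 0 2 - 2 * g 1 0 1) (- 2 * g 1 0 2 - 2 * g 2 0 1)
  (2 * g 1 1 2 - g 2 2 2 + g 2 1 1) (g 1 2 2 - g 1 1 1 + 2 * g 2 1 2).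
  move=> x y xy; have x2 : x ^+ 2 = 1 - y ^+ 2 by rewrite -xy addrK.
  rewrite -[RHS](sg0 _ (null_circle_point x y xy)) !sum3E !circle_pointE.
  rewrite (gC 1 1 0) (gC 1 2 0) (gC 1 2 1) (gC 2 1 0) (gC 2 2 0) (gC 2 2 1).
  by ring: x2.
move=> a0 b0 c0 d0 [e0 f0 k0].
by clear g0 sg0; split; lra.
Qed.

(** Only the symmetric part of [N] is constrained: it must be a multiple of the Minkowski metric. *)
Lemma quadratic_null_conditionE (N : 'I_3 -> 'I_3 -> R) :
    quadratic_null_condition N ->
  [/\ N 1 1 = - N 0 0, N 2 2 = - N 0 0, N 1 0 = - N 0 1, N 2 0 = - N 0 2 &
      N 2 1 = - N 1 2].
Proof.
move=> N0.
(* A quadratic form has no cubic monomials, hence the two final zeros. *)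
have [|] := @circle_cubic_eq0 (N 0 0 + N 1 1) (- N 0 1 - N 1 0)
  (- N 0 2 - N 2 0) (N 1 2 + N 2 1) (N 2 2 - N 1 1) 0 0.
  move=> x y xy; have x2 : x ^+ 2 = 1 - y ^+ 2 by rewrite -xy addrK.
  rewrite -[RHS](N0 _ (null_circle_point x y xy)) !sum3E !circle_pointE.
  by ring: x2.
move=> a0 b0 c0 d0 [e0 _ _].
by clear N0; split; lra.
Qed.

Lemma quadratic_null_formE (N : 'I_3 -> 'I_3 -> R) (v : 'I_3 -> R) :
    quadratic_null_condition N ->
  \sum_(i < 3) \sum_(j < 3) N i j * v i * v j
    = N 0 0 * (v 0 ^+ 2 - (v 1 ^+ 2 + v 2 ^+ 2)).
Proof.
move=> /quadratic_null_conditionE[h1 h2 h3 h4 h5].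
by rewrite !sum3E h1 h2 h3 h4 h5; ring.
Qed.

(** Derivatives are replaced by free variables [v] and [w]. The coefficients on the right are read
    off from the eleven monomials whose entry of [g] is free, for instance v_0 w_01 fixes that of
    [A 1]; the other seven monomials match by [null_conditionE]. *)
Lemma null_formE (g : 'I_3 -> 'I_3 -> 'I_3 -> R)
    (v : 'I_3 -> R) (w : 'I_3 -> 'I_3 -> R) :
    (forall k i j, g k i j = g k j i) -> null_condition g ->
    (forall i j, w i j = w j i) ->
  let A i := 2 * (v 0 * w i 0 - v 1 * w i 1 - v 2 * w i 2) in
  let box := w 0 0 - (w 1 1 + w 2 2) in
  \sum_(k < 3) \sum_(i < 3) \sum_(j < 3) g k i j * v k * w i j =
    (- g 2 0 2 * A 0 + g 0 0 1 * A 1 + g 0 0 2 * A 2)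
    + (- g 0 2 2 * (v 0 * box) + g 1 0 0 * (v 1 * box) + g 2 0 0 * (v 2 * box))
    + (2 * g 0 1 2 * (v 0 * w 1 2 - v 1 * w 0 2)
       + - 2 * g 2 0 1 * (v 1 * w 0 2 - v 2 * w 0 1))
    + ((g 0 1 1 - g 0 2 2) * (v 0 * w 1 1 - v 1 * w 0 1)
       + (g 1 2 2 + g 1 0 0) * (v 1 * w 2 2 - v 2 * w 1 2)
       + (g 2 1 1 + g 2 0 0) * (v 2 * w 1 1 - v 1 * w 1 2)).
Proof.
move=> gC g0 wC A box.
have [h1 h2 h3 [h4 h5 h6 h7]] := null_conditionE g gC g0.
rewrite !sum3E /A /box (wC 1 0) (wC 2 0) (wC 2 1).
rewrite (gC 0 1 0) (gC 0 2 0) (gC 0 2 1) (gC 1 1 0) (gC 1 2 0) (gC 1 2 1).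
rewrite (gC 2 1 0) (gC 2 2 0) (gC 2 2 1) h1 h2 h3 h4 h5 h6 h7.
by field.
Qed.

End NullForms.

(** * The decompositions for functions [u] *)

Lemma quadratic_termE (R : realType) (g : 'I_3 -> 'I_3 -> 'I_3 -> R) :
    (forall k i j, g k i j = g k j i) -> null_condition g ->
  forall u, Ck 2 u -> forall p, quadratic_term g u p =
    (- g 2 0 2 * FA u 0 p + g 0 0 1 * FA u 1 p + g 0 0 2 * FA u 2 p)
    + (- g 0 2 2 * FB u 0 p + g 1 0 0 * FB u 1 p + g 2 0 0 * FB u 2 p)
    + (2 * g 0 1 2 * FC u 1 p + - 2 * g 2 0 1 * FC u 2 p)
    + ((g 0 1 1 - g 0 2 2) * FD u 1 p + (g 1 2 2 + g 1 0 0) * FD u 2 p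
       + (g 2 1 1 + g 2 0 0) * FD u 3 p).
Proof.
move=> gC g0 u C2 p; rewrite !FAE//.
exact: (null_formE g (fun k => partial k u p)
  (fun i j => partial i (partial j u) p) gC g0
  (fun i j => partialC u C2 i j p)).
Qed.

Theorem theorem1p2 (R : realType) :
  (forall g : 'I_3 -> 'I_3 -> 'I_3 -> R,
    (forall k i j, g k i j = g k j i) ->
    (null_condition g ->
      exists C : nat -> nat -> R,
      forall u : 'rV[R]_3 -> R, Ck 2 u -> forall p : 'rV[R]_3,
        quadratic_term g u p =
          \sum_(l < 3) C 1%N l * FA u l p
          + \sum_(l < 3) C 2%N l * FB u l p
          + \sum_(1 <= l < 3) C 3%N l * FC u l p
          + \sum_(1 <= l < 4) C 4%N l * FD u l p)
    /\
    (strong_null_condition g ->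
      exists C : nat -> nat -> R,
      forall u : 'rV[R]_3 -> R, Ck 2 u -> forall p : 'rV[R]_3,
        quadratic_term g u p =
          \sum_(l < 3) C 1%N l * FA u l p
          + \sum_(l < 3) C 2%N l * FB u l p))
  /\
  (forall (A : 'I_3 -> R) (N : 'I_3 -> 'I_3 -> R),
    quadratic_null_condition N ->
    exists C : nat -> nat -> R,
    forall u : 'rV[R]_3 -> R, Ck 2 u -> forall p : 'rV[R]_3,
      \sum_(l < 3)
         A l * partial l (fun q => \sum_(i < 3) \sum_(j < 3)
                                     N i j * partial i u q * partial j u q) p
      = \sum_(l < 3) C 1%N l * FA u l p).
Proof.
split=> [g gC|A N N0]; first split=> [g0|sg0].
(* Row [m] lists the constants C_{m,l}. Row 0 is a dummy, and rows 3 and 4 begin with a padding 0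
   because [FC] and [FD] are indexed from 1. *)
- exists (fun m l => nth 0 (nth [::] [:: [::]; [:: - g 2 0 2; g 0 0 1; g 0 0 2];
    [:: - g 0 2 2; g 1 0 0; g 2 0 0]; [:: 0; 2 * g 0 1 2; - 2 * g 2 0 1];
    [:: 0; g 0 1 1 - g 0 2 2; g 1 2 2 + g 1 0 0; g 2 1 1 + g 2 0 0]] m) l).
  move=> u C2 p; rewrite (quadratic_termE R g gC g0 u C2).
  by rewrite !sum3E sum_nat13 sum_nat14.
- have [h1 h2 h3 h4 h5] := strong_null_conditionE g gC sg0.
  exists (fun m l => nth 0 (nth [::] [:: [::]; [:: - g 2 0 2; g 0 0 1; g 0 0 2];
    [:: - g 0 2 2; g 1 0 0; g 2 0 0]] m) l).
  move=> u C2 p; rewrite (quadratic_termE R g gC sg0.1 u C2).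
  rewrite !sum3E h1 h2 h3 h4 h5.
  (* The null forms become opaque atoms, so that [ring] sees only their coefficients. *)
  move: (FC u 1 p) (FC u 2 p) (FD u 1 p) (FD u 2 p) (FD u 3 p).
  move: (FA u 0 p) (FA u 1 p) (FA u 2 p) (FB u 0 p) (FB u 1 p) (FB u 2 p).
  by move=> * /=; ring.
(* The quadratic form in the first derivatives is [N 0 0] times [minkowski u], so each C_{1,l} is
   [A l * N 0 0]. *)
- exists (fun _ l => nth 0 [:: A 0 * N 0 0; A 1 * N 0 0; A 2 * N 0 0] l).
  move=> u C2 p.
  have -> : (fun q => \sum_(i < 3) \sum_(j < 3)
      N i j * partial i u q * partial j u q) = (fun q => N 0 0 * minkowski u q).
    by apply/funext => q; exact: (quadratic_null_formE N (fun i => partial i u q) N0).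
  by rewrite !sum3E !partialZ_minkowski// !mulrA.
Qed.
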